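(* Let $\mathcal H$, $\mathcal G$ and $\Theta$ be Euclidean spaces, let $C\subset\Theta$ be a closed convex set, and let $R\colon\mathcal G\to\mathcal G$ be a firmly nonexpansive operator. Let $\theta\mapsto(W_\theta,b_\theta)$ be a linear map from $\Theta$ to the space of pairs consisting of a linear operator $W_\theta\colon\mathcal H\to\mathcal G$ and a vector $b_\theta\in\mathcal G$. Let $(x_k,y_k)_{1\leq k\leq K}\in(\mathcal H\times\mathcal G)^K$ and, for every $k\in\{1,\ldots,K\}$, let $L_k\colon\Theta\to\mathcal G$ be the linear operator $L_k\theta=W_\theta x_k+b_\theta$, let $L_k^*\colon\mathcal G\to\Theta$ be its adjoint, and let $\omega_k\in\left]0,1\right[$, where $\sum_{k=1}^K\omega_k=1$. Consider the variational inequality problem $$\text{find }\theta\in C\text{ such that }(\forall\vartheta\in C)\quad\Big\langle\vartheta-\theta\;\Big|\;\sum_{k=1}^K\omega_kL_k^*\big(R(L_k\theta)-y_k\big)\Big\rangle\geq 0,\qquad(\mathrm{VI})$$ and assume that $(\mathrm{VI})$ has at least one solution. Let $\gamma\in\left]0,\,2/\max_{1\leq k\leq K}\|L_k\|^2\right[$, let $\theta_0\in\Theta$, let $(\vartheta_{k,0})_{1\leq k\leq K}\in\Theta^K$, and let $(\mathbb K_n)_{n\in\mathbb N}$ be a sequence of nonempty subsets of $\{1,\ldots,K\}$. For every $n\in\mathbb N$ define $$\vartheta_{k,n+1}=\begin{cases}\theta_n-\gamma L_k^*\big(R(L_k\theta_n)-y_k\big),&\text{if }k\in\mathbb K_n;\\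 \vartheta_{k,n},&\text{if }k\in\{1,\ldots,K\}\smallsetminus\mathbb K_n,\end{cases}\qquad \theta_{n+1}=\mathrm{proj}_C\Big(\sum_{k=1}^K\omega_k\vartheta_{k,n+1}\Big).$$ Suppose that there exists $P\in\mathbb N$ such that, for every $n\in\mathbb N$, $\bigcup_{k=0}^{P-1}\mathbb K_{n+k}=\{1,\ldots,K\}$ (that is, every index is selected at least once within any $P$ consecutive iterations). Then the sequence $(\theta_n)_{n\in\mathbb N}$ converges to a solution of $(\mathrm{VI})$.
   Context: Euclidean spaces are finite-dimensional real inner product spaces, with inner product $\langle\cdot\mid\cdot\rangle$ and norm $\|\cdot\|$; $\|L_k\|$ denotes the operator norm. An operator $R\colon\mathcal G\to\mathcal G$ is firmly nonexpansive if, for every $z_1,z_2\in\mathcal G$, $\langle z_1-z_2\mid Rz_1-Rz_2\rangle\geq\|Rz_1-Rz_2\|^2$. For a nonempty closed convex set $C\subset\Theta$, $\mathrm{proj}_C$ denotes the metric projection onto $C$. $\left]a,b\right[$ denotes the open interval, and $\mathbb N=\{0,1,2,\ldots\}$. *)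

(* Defs.v *)
From HB Require Import structures.
From mathcomp Require Import all_boot all_order all_algebra.
From mathcomp Require Import all_classical all_reals all_analysis.

Set Implicit Arguments.
Unset Strict Implicit.
Unset Printing Implicit Defensive.

Import Order.TTheory GRing.Theory Num.Theory.
Import numFieldNormedType.Exports.

Local Open Scope classical_set_scope.
Local Open Scope ring_scope.

(* [normedModType] provides the norm and its topology, [vectType] the finite
   dimension; [norm_dotp] says that the norm is the one of the inner product. *)
HB.mixin Record NormedVector_isEuclidean (R : realType) V
    & NormedModule R V & Vector R V := {
  dotp : {dot V for idfun};
  norm_dotp : forall x : V, `|x| = Num.sqrt (dotp x x)
}.

#[short(type="euclideanType")]
HB.structure Definition Euclidean (R : realType) :=
  {V of NormedModule R V & Vector R V & NormedVector_isEuclidean R V}.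

Section Operators.
Variables (R : realType) (U V : euclideanType R).

Definition opnorm (L : {linear U -> V}) : R :=
  sup [set `|L u| | u in [set u : U | `|u| <= 1]].

(* The condition determines [w] uniquely, and such a [w] exists because [U] is
   finite-dimensional, so the default value [0] is never returned. *)
Definition adjoint (L : {linear U -> V}) (v : V) : U :=
  xget 0 [set w : U | forall u : U, dotp (L u) v = dotp u w].

Definition firmly_nonexpansive (F : V -> V) : Prop :=
  forall z1 z2 : V, `|F z1 - F z2| ^+ 2 <= dotp (z1 - z2) (F z1 - F z2).

(* The nearest point exists and is unique when [C] is nonempty, closed and
   convex; the value is meaningful only in that case. *)
Definition metric_proj (C : set V) (v : V) : V :=
  xget 0 [set p : V | C p /\ forall c : V, C c -> `|v - p| <= `|v - c|].

Definition VI_solution (C : set V) (B : V -> V) : set V :=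
  [set p : V | C p /\ forall c : V, C c -> 0 <= dotp (c - p) (B p)].

End Operators.

Section Layer.
Variables (R : realType) (H G Theta : euclideanType R).
Variables (Wb : {linear Theta -> ('Hom(H, G) * G)%type}) (x : H).

Definition layer (theta : Theta) : G := (Wb theta).1 x + (Wb theta).2.

Fact layer_is_linear : linear layer.
Proof.
move=> a s t; rewrite /layer linearP /= add_lfunE scale_lfunE scalerDr.
by rewrite addrACA.
Qed.

HB.instance Definition _ :=
  GRing.isLinear.Build R Theta G *:%R layer layer_is_linear.

End Layer.

(* Main.v *)
(* Fix a solution q. One activation of block k is a gradient-type step for the
   cocoercive operator B_k t = L_k^*(F (L_k t) - y_k), so it contracts the
   distance to its value at q up to the gain
   gamma (2 - gamma beta) |F (L_k t) - F (L_k q)|^2. Averaging over k (with the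
   variance term) and projecting (firm nonexpansiveness) gives, for
   a_n = |theta_n - q|^2,
     a_{n+P+1} + e_n <= sum_k omega_k a_{p_k(n)},
   where p_k(n), in [n, n+P], is the last activation time of k. Since some block
   is activated at time n+P, the right-hand side puts a weight bounded away from
   0 on a_{n+P}; hence a_n converges and e_n -> 0. This forces
   F (L_k theta_n) -> F (L_k q) for every k, and theta_n minus the average of
   the vtheta_{k,n} tends to gamma sum_k omega_k B_k q. Passing to the limit in
   the variational characterization of the projection, every cluster point t of
   theta_n solves the variational inequality; applying the convergence of a_n
   with q := t then gives theta_n -> t. *)
Require Import Defs.
From HB Require Import structures.
From mathcomp Require Import all_boot all_order all_algebra.
From mathcomp Require Import all_classical all_reals all_analysis.
From mathcomp Require Import ring lra.
Import Order.TTheory GRing.Theory Num.Theory.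
Import numFieldNormedType.Exports.
Local Open Scope classical_set_scope.
Local Open Scope ring_scope.

Set Implicit Arguments.
Unset Strict Implicit.
Unset Printing Implicit Defensive.

(** * Inner products, compactness and metric projections *)

Section EuclideanSpace.
Variables (R : realType) (V : euclideanType R).
Implicit Types u v w : V.

Lemma dotpC u v : dotp u v = dotp v u.
Proof. by rewrite hermC /= expr0 mul1r. Qed.

Lemma dotpDl u v w : dotp (u + v) w = dotp u w + dotp v w.
Proof. exact: linearDl. Qed.

Lemma dotpZl a u w : dotp (a *: u) w = a * dotp u w.
Proof. exact: linearZl_LR. Qed.

Lemma dotpDr u v w : dotp w (u + v) = dotp w u + dotp w v.
Proof. by rewrite !(dotpC w) dotpDl. Qed.

Lemma dotpZr a u w : dotp w (a *: u) = a * dotp w u.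
Proof. by rewrite !(dotpC w) dotpZl. Qed.

Lemma dotpNl u v : dotp (- u) v = - dotp u v.
Proof. by rewrite -scaleN1r dotpZl mulN1r. Qed.

Lemma dotpNr u v : dotp u (- v) = - dotp u v.
Proof. by rewrite dotpC dotpNl dotpC. Qed.

Lemma dotpBl u v w : dotp (u - v) w = dotp u w - dotp v w.
Proof. by rewrite dotpDl dotpNl. Qed.

Lemma dotpBr u v w : dotp w (u - v) = dotp w u - dotp w v.
Proof. by rewrite dotpDr dotpNr. Qed.

Lemma dotp0l u : dotp 0 u = 0.
Proof. by rewrite -(scale0r 0) dotpZl mul0r. Qed.

Lemma dotp0r u : dotp u 0 = 0.
Proof. by rewrite dotpC dotp0l. Qed.

Lemma dotp_suml (I : finType) (f : I -> V) u :
  dotp (\sum_i f i) u = \sum_i dotp (f i) u.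
Proof.
by elim/big_rec2 : _ => [|i y1 y2 _ <-]; rewrite ?dotp0l ?dotpDl.
Qed.

Lemma sqr_norm_dotp u : `|u| ^+ 2 = dotp u u.
Proof.
rewrite norm_dotp sqr_sqrtr //; have [->|u0] := eqVneq u 0.
  by rewrite dotp0r.
exact/ltW/neq0_dnorm_gt0.
Qed.

Lemma normD_sqr u v : `|u + v| ^+ 2 = `|u| ^+ 2 + 2 * dotp u v + `|v| ^+ 2.
Proof.
rewrite !sqr_norm_dotp dotpDl !dotpDr (dotpC v u); ring.
Qed.

Lemma normB_sqr u v : `|u - v| ^+ 2 = `|u| ^+ 2 - 2 * dotp u v + `|v| ^+ 2.
Proof. by rewrite normD_sqr dotpNr normrN mulrN. Qed.

Lemma cauchy_schwarz u v : dotp u v <= `|u| * `|v|.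
Proof.
have [->|u0] := eqVneq u 0; first by rewrite dotp0l normr0 mul0r.
have [->|v0] := eqVneq v 0; first by rewrite dotp0r normr0 mulr0.
have un : 0 < `|u| by rewrite normr_gt0.
have vn : 0 < `|v| by rewrite normr_gt0.
have := sqr_ge0 `| `|v| *: u - `|u| *: v|.
rewrite normB_sqr !normrZ dotpZl dotpZr !normr_id !exprMn.
set d := dotp u v => h.
have {}h : `|u| * `|v| * d <= `|u| * `|v| * (`|u| * `|v|) by nra.
by rewrite ler_pM2l ?mulr_gt0 in h.
Qed.

Lemma norm_dotp_le u v : `|dotp u v| <= `|u| * `|v|.
Proof.
rewrite ler_norml cauchy_schwarz andbT lerNl -dotpNl -[`|u|]normrN.
exact: cauchy_schwarz.
Qed.

(** Pairing with an arbitrary [w] reduces vector identities to scalar ones that [ring] settles. *)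
Lemma dotp_inj u v : (forall w, dotp u w = dotp v w) -> u = v.
Proof.
move=> uv; apply/eqP; rewrite -subr_eq0 -normr_eq0 -sqrf_eq0 sqr_norm_dotp.
by rewrite dotpBl uv subrr.
Qed.

(* The map w |-> (<e_i, w>)_i is injective, hence onto by a dimension count. *)
Lemma riesz (f : V -> R) :
  (forall a u v, f (a *: u + v) = a * f u + f v) ->
  exists w, forall v, f v = dotp v w.
Proof.
move=> flin.
pose e := vbasis (fullv : {vspace V}).
pose phi w : 'rV[R]_(\dim (fullv : {vspace V})) := \row_i dotp e`_i w.
have phiL : linear phi.
  by move=> a u v; apply/rowP => i; rewrite !mxE dotpDr dotpZr.
have exp v : v = \sum_i coord e i v *: e`_i.
  by apply: coord_vbasis; rewrite memvf.
have f0 : f 0 = 0 by have := flin 1 0 0; rewrite scale1r addr0 mul1r => h; lra.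
have fsum (I : finType) (c : I -> R) (g : I -> V) :
    f (\sum_i c i *: g i) = \sum_i c i * f (g i).
  elim/big_rec2 : _ => [//|i y1 y2 _ <-]; exact: flin.
have dsum v w : dotp v w = \sum_i coord e i v * dotp e`_i w.
  rewrite {1}(exp v) dotp_suml; apply: eq_bigr => i _.
  by rewrite dotpZl.
pose phiM := GRing.isLinear.Build _ _ _ _ phi phiL.
pose phiH : {linear V -> 'rV_(\dim (fullv : {vspace V}))} :=
  HB.pack phi phiM.
pose h := linfun phiH.
have kh : lker h == 0%VS.
  rewrite -subv0; apply/subvP => w; rewrite memv_ker lfunE /= => /eqP pw.
  rewrite memv0; have [//|w0] := eqVneq w 0.
  suff : dotp w w = 0 by move/eqP; rewrite gt_eqF ?neq0_dnorm_gt0.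
  rewrite dsum big1 // => i _; move/rowP : pw => /(_ i); rewrite !mxE => ->.
  by rewrite mulr0.
have lh : limg h = fullv.
  apply/eqP; rewrite eqEdim subvf /= limg_dim_eq; last first.
    by rewrite (eqP kh) capv0.
  by rewrite !dimvf /dim /= mul1n.
have : (\row_i f e`_i : 'rV[R]_(\dim (fullv : {vspace V}))) \in limg h.
  by rewrite lh memvf.
case/memv_imgP => w _; rewrite lfunE /= => /rowP hw.
exists w => v; rewrite dsum {1}(exp v) fsum; apply: eq_bigr => i _.
by have := hw i; rewrite !mxE => ->.
Qed.

(** Each coordinate is a linear form, hence the pairing with a Riesz vector, whose norm serves as
    the constant. *)
Lemma coord_bounded : exists c : 'I_(\dim (fullv : {vspace V})) -> R,
  forall i, 0 <= c i /\ forall v, `|coord (vbasis fullv) i v| <= c i * `|v|.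
Proof.
have : forall i : 'I_(\dim (fullv : {vspace V})), exists c : R,
    0 <= c /\ forall v, `|coord (vbasis fullv) i v| <= c * `|v|.
  move=> i; have [|w hw] := @riesz (coord (vbasis fullv) i).
    by move=> a u v; rewrite linearP.
  by exists `|w|; split=> // v; rewrite hw mulrC norm_dotp_le.
by move=> /choice[c hc]; exists c.
Qed.

(** [A] sits inside the continuous image, under [g], of a compact box of coordinate vectors. *)
Lemma euclidean_bounded_closed_compact (A : set V) (M : R) :
  closed A -> (forall v, A v -> `|v| <= M) -> compact A.
Proof.
move=> Acl AM; have [c hc] := coord_bounded.
pose e := vbasis (fullv : {vspace V}).
pose g (r : 'rV[R]_(\dim (fullv : {vspace V}))) : V := \sum_i r 0 i *: e`_i.
pose B := [set r : 'rV[R]_(\dim (fullv : {vspace V})) |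
  forall i, r ord0 i \in `[- (c i * M), c i * M]].
have Bc : compact B.
  apply: (@rV_compact _ _ (fun i => `[- (c i * M), c i * M]%classic)).
  by move=> i; apply: segment_compact.
have gc : continuous g.
  apply: continuous_big => [|i _]; first exact: add_continuous.
  move=> r; apply: (@cvgZr_tmp _ _ _ (nbhs r)).
  exact: (@coord_continuous R 1).
have gB : compact (g @` B).
  by apply: continuous_compact => //; exact: continuous_subspaceT.
apply: subclosed_compact Acl gB _ => v Av.
exists (\row_i coord e i v).
  move=> i; rewrite mxE in_itv /= -ler_norml (le_trans ((hc i).2 v)) //.
  by rewrite ler_wpM2l ?AM ?(hc i).1.
by rewrite /g [RHS](coord_vbasis (memvf v)); apply: eq_bigr => i _; rewrite mxE.
Qed.

(** [x] is a cluster point; [n <= phi n] is all that [cvg_subseq] asks of [phi] to carry limits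
    over. *)
Lemma bounded_cvg_subseq (u : nat -> V) (M : R) : (forall n, `|u n| <= M) ->
  exists x : V, exists2 phi : nat -> nat,
    (forall n, (n <= phi n)%N) & u (phi n) @[n --> \oo] --> x.
Proof.
move=> uM; pose A := [set v : V | `|v| <= M].
have Acl : closed A.
  have -> : A = (fun v : V => `|v|) @^-1` [set r : R | r <= M] by [].
  apply: preimage_closed => [v _|]; first exact: norm_continuous.
  exact: closed_le.
have Ac : compact A by apply: (@euclidean_bounded_closed_compact A M).
have uA : (u n @[n --> \oo]) A by exists 0%N => // n _; exact: uM.
have [x [_ xcl]] := Ac (u n @[n --> \oo]) _ uA.
have near_x n : exists m : nat, (n <= m)%N /\ `|x - u m| < n.+1%:R^-1.
  have [||y [[m nm <-]]] := xcl (u @` [set m | (n <= m)%N]) (ball x n.+1%:R^-1).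
  - by exists n => // m nm; exists m.
  - by apply: nbhsx_ballx; rewrite invr_gt0.
  by rewrite -ball_normE /= => h; exists m.
have [phi hphi] := choice near_x.
exists x, phi => [n|]; first by have [] := hphi n.
apply/cvgrPdist_lt => e e0.
near=> n; apply: lt_trans (hphi n).2 _.
by near: n; exact: near_infty_natSinv_lt (PosNum e0).
Unshelve. all: by end_near. Qed.

Lemma metric_projP (C : set V) v : closed C -> C !=set0 ->
  C (metric_proj C v) /\ forall c, C c -> `|v - metric_proj C v| <= `|v - c|.
Proof.
move=> Ccl [c0 Cc0].
(* Keeping only the points of [C] no farther from [v] than [c0] gives compactness without changing
   the minimum. *)
pose A := C `&` [set c : V | `|v - c| <= `|v - c0|].
have fc : continuous (fun c : V => `|v - c|).
  move=> c; apply: cvg_norm; apply: cvgB; [exact: cvg_cst|exact: cvg_id].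
have Acl : closed A.
  apply: closedI => //.
  have -> : [set c : V | `|v - c| <= `|v - c0|] =
     (fun c : V => `|v - c|) @^-1` [set r : R | r <= `|v - c0|] by [].
  by apply: preimage_closed => [c _|]; [exact: fc|exact: closed_le].
have Ac : compact A.
  apply: (@euclidean_bounded_closed_compact _ (`|v - c0| + `|v|)) => //.
  move=> c [_ /= h].
  by have := ler_normB v (v - c); rewrite subKr => /le_trans; apply;
    rewrite addrC lerD2r.
have [|p] := @compact_EVT_min _ _ _ A _ Ac (continuous_subspaceT fc).
  by exists c0; split=> //=.
rewrite inE => -[Cp _] pmin.
rewrite /metric_proj; case: xgetP => [y -> [Cy hy] //|/(_ p)[]].
split=> // c Cc.
have [cc0|/ltW c0c] := leP `|v - c| `|v - c0|.
  by apply: pmin; rewrite inE.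
by apply: le_trans c0c; apply: pmin; rewrite inE; split=> //=.
Qed.

(** Moving from the projection towards [c] by a fraction [t] does not bring the point closer to [v],
    so the first-order term in [t] is nonnegative. *)
Lemma metric_proj_var (C : set V) v : closed C -> convex_set C ->
  C !=set0 -> forall c, C c ->
  0 <= dotp (c - metric_proj C v) (metric_proj C v - v).
Proof.
move=> Ccl Ccv C0 c Cc; have [] := metric_projP v Ccl C0.
set p := metric_proj C v => Cp pmin.
set d := dotp _ _.
have key (t : R) : 0 < t -> t < 1 -> 0 <= 2 * d + t * `|c - p| ^+ 2.
  move=> t0 t1.
  have Ct : C (p + t *: (c - p)).
    have := Ccv c p (Itv01 (ltW t0) (ltW t1)); rewrite !inE => /(_ Cc Cp).
    suff -> : p + t *: (c - p) = t *: c + (1 - t) *: p by [].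
    by rewrite scalerBr scalerBl scale1r addrCA.
  have := pmin _ Ct.
  rewrite -ler_sqr ?nnegrE // opprD addrA [leRHS]normB_sqr normrZ exprMn.
  rewrite dotpZr dotpC -[v - p]opprB dotpNr -/d (gtr0_norm t0) => h.
  by rewrite -(pmulr_rge0 _ t0); lra.
rewrite leNgt; apply/negP => d0.
have n0 : 0 <= `|c - p| ^+ 2 by exact: sqr_ge0.
have q0 : 0 < `|c - p| ^+ 2 + 1 - d by lra.
(* With [d < 0], this [t] lies in ]0,1[ and satisfies $t|c-p|^2 < -d$, so the expression in [key]
   would fall below [d]. *)
pose t := - d / (`|c - p| ^+ 2 + 1 - d).
have t0 : 0 < t by rewrite divr_gt0 ?oppr_gt0.
have t1 : t < 1 by rewrite ltr_pdivrMr // mul1r; lra.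
have tq : t * (`|c - p| ^+ 2 + 1 - d) = - d by rewrite divfK // gt_eqF.
have := key t t0 t1; nra.
Qed.
End EuclideanSpace.

(** * Operator norm and adjoint *)

Section Operators.
Variables (R : realType) (U V : euclideanType R) (L : {linear U -> V}).

(** This makes the [sup] in [opnorm] a genuine supremum; the bound comes from expanding [v] in a
    basis. *)
Lemma opnorm_has_ubound :
  has_ubound [set `|L u| | u in [set u : U | `|u| <= 1]].
Proof.
have [c hc] := coord_bounded U.
pose e := vbasis (fullv : {vspace U}).
exists (\sum_i c i * `|L e`_i|) => _ [v /= v1 <-].
rewrite [v](coord_vbasis (memvf v)) linear_sum /=.
rewrite (le_trans (ler_norm_sum _ _ _)) // ler_sum // => i _.
rewrite linearZ normrZ ler_wpM2r // (le_trans ((hc i).2 v)) //.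
by rewrite ler_piMr // (hc i).1.
Qed.

Lemma opnorm_le u : `|L u| <= opnorm L * `|u|.
Proof.
have [->|u0] := eqVneq u 0; first by rewrite linear0 !normr0 mulr0.
have un : 0 < `|u| by rewrite normr_gt0.
rewrite -ler_pdivrMr //.
have -> : `|L u| / `|u| = `|L (`|u|^-1 *: u)|.
  by rewrite linearZ normrZ normfV normr_id mulrC.
apply: ub_le_sup; first exact: opnorm_has_ubound.
by exists (`|u|^-1 *: u) => //=; rewrite normrZ normfV normr_id mulVf // gt_eqF.
Qed.

Lemma opnorm_ge0 : 0 <= opnorm L.
Proof.
rewrite -(normr0 V) -(linear0 L); apply: ub_le_sup.
  exact: opnorm_has_ubound.
by exists 0; rewrite //= normr0.
Qed.

(** The Riesz vector of $u \mapsto \langle Lu \mid v\rangle$ rules out the default value of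
    [xget]. *)
Lemma adjointP u v : dotp (L u) v = dotp u (adjoint L v).
Proof.
rewrite /adjoint; case: xgetP => [w -> //|h].
have [|w hw] := @riesz _ U (fun u => dotp (L u) v).
  by move=> a x y; rewrite linearP dotpDl dotpZl.
by case: (h w).
Qed.

Lemma adjoint_le v : `|adjoint L v| <= opnorm L * `|v|.
Proof.
have [->|w0] := eqVneq (adjoint L v) 0.
  by rewrite normr0 mulr_ge0 // opnorm_ge0.
have wn : 0 < `|adjoint L v| by rewrite normr_gt0.
rewrite -(ler_pM2l wn) -expr2 sqr_norm_dotp -adjointP.
rewrite (le_trans (cauchy_schwarz _ _)) // mulrA ler_wpM2r // mulrC.
exact: opnorm_le.
Qed.

Lemma adjointB v w : adjoint L (v - w) = adjoint L v - adjoint L w.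
Proof.
apply: dotp_inj => u.
by rewrite dotpC [RHS]dotpC dotpBr -!adjointP dotpBr.
Qed.

End Operators.

(** * Scalar sequences controlled by a sliding-window maximum *)

Lemma window_max (R : realType) (a : nat -> R) (P n : nat) : exists M : R,
  (forall j, (j <= P)%N -> a (n + j)%N <= M) /\
  (exists2 j, (j <= P)%N & a (n + j)%N = M).
Proof.
elim: P => [|P [M [aM [j jP aj]]]].
  exists (a n); split; last by exists 0%N; rewrite ?addn0.
  by move=> j; rewrite leqn0 => /eqP ->; rewrite addn0.
have [Ma|/ltW aM'] := leP M (a (n + P.+1)%N).
  exists (a (n + P.+1)%N); split; last by exists P.+1.
  move=> k; rewrite leq_eqVlt => /predU1P[-> //|kP].
  exact: le_trans (aM _ kP) Ma.
exists M; split; last by exists j => //; exact: leqW.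
move=> k; rewrite leq_eqVlt => /predU1P[-> //|kP]; exact: aM.
Qed.

(* With M_n the maximum of a over [n, n+P], a gap M_n - a_{n+P} persists, up to
   a factor w^P, in M_n - M_{n+P}, which tends to 0. *)
Lemma asynchronous_descent (R : realType) (a e : nat -> R) (w : R) (P : nat) :
  (forall n, 0 <= a n) -> (forall n, 0 <= e n) -> 0 < w -> w <= 1 ->
  (forall n M, (forall j, (j <= P)%N -> a (n + j)%N <= M) ->
    a (n + P).+1 + e n <= w * a (n + P)%N + (1 - w) * M) ->
  cvgn a /\ e n @[n --> \oo] --> 0.
Proof.
move=> a0 e0 w0 w1 step.
have [M hM] := choice (window_max a P).
have aM n j : (j <= P)%N -> a (n + j)%N <= M n by have [] := hM n; auto.
(* The next window adds only [a (n + P).+1], which [step] bounds by a convex combination of values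
   at most [M n]. *)
have MS n : M n.+1 <= M n.
  have [_ [j jP <-]] := hM n.+1.
  move: jP; rewrite leq_eqVlt => /predU1P[->|jP]; last first.
    by rewrite addSnnS; apply: aM.
  have := step n (M n) (aM n); have := e0 n; have := aM n P (leqnn _).
  rewrite addSn; nra.
have Mle n j : M (n + j)%N <= M n.
  by elim: j => [|j IH]; rewrite ?addn0 // addnS (le_trans (MS _)).
have M0 n : 0 <= M n by rewrite (le_trans (a0 (n + 0)%N)) // aM.
have Mcv : cvgn M.
  apply: nonincreasing_is_cvgn.
    by apply/nonincreasing_seqP.
  by exists 0 => _ [n _ <-].
pose rho := limn M.
have Mrho : M n @[n --> \oo] --> rho by [].
have MrhoP k : M (n + k)%N @[n --> \oo] --> rho.
  by rewrite (cvg_shiftn k).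
(* Each use of [step] keeps at least a fraction [w] of the gap below [M n]. *)
have gap n j : a (n + P + j)%N <= M n - w ^+ j * (M n - a (n + P)%N).
  elim: j => [|j IH]; first by rewrite addn0 expr0 mul1r; lra.
  have := step (n + j)%N (M (n + j)%N) (aM _); have := e0 (n + j)%N.
  rewrite addnS addnAC exprS; have := Mle n j; nra.
have wj j : (j <= P)%N -> w ^+ P <= w ^+ j.
  by move=> jP; apply: ler_wiXn2l => //; exact: ltW.
have wP : 0 < w ^+ P by exact: exprn_gt0.
(* [M (n + P)] is attained at some offset [j <= P], where [gap] applies; [w ^+ P <= w ^+ j] removes
   the dependence on [j]. *)
have low n : M n - (M n - M (n + P)%N) / w ^+ P <= a (n + P)%N.
  have [_ [j jP]] := hM (n + P)%N => aj.
  have := gap n j; rewrite aj => h.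
  have d0 : 0 <= M n - a (n + P)%N by rewrite subr_ge0 aM.
  rewrite lerBlDr -lerBlDl ler_pdivlMr //.
  have := ler_wpM2r d0 (wj _ jP); lra.
have aP : a (n + P)%N @[n --> \oo] --> rho.
  apply: (@squeeze_cvgr _ _ _ _
    (fun n => M n - (M n - M (n + P)%N) / w ^+ P) M).
  - by near=> n; rewrite low aM.
  - rewrite -[X in _ --> X]subr0 -(mul0r (w ^+ P)^-1) -(subrr rho).
    by apply: cvgB => //; apply: cvgMr_tmp; apply: cvgB.
  - by [].
have aPS : a (n + P).+1 @[n --> \oo] --> rho.
  have -> : (fun n => a (n + P).+1) = (fun n => a (n + P.+1)%N).
    by apply/funext => n; rewrite addnS.
  by rewrite (cvg_shiftn P.+1) -(cvg_shiftn P).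
split; first by apply/cvg_ex; exists rho; rewrite -(cvg_shiftn P).
(* [e] lies below the slack left in [step], whose terms have limits that cancel. *)
apply: (@squeeze_cvgr _ _ _ _ (fun=> 0)
  (fun n => w * a (n + P)%N + (1 - w) * M n - a (n + P).+1)).
- by near=> n; rewrite e0 /= lerBrDl; apply: step => j; exact: aM.
- exact: cvg_cst.
- have -> : 0 = w * rho + (1 - w) * rho - rho by ring.
  apply: cvgB => //; apply: cvgD; exact: cvgMl_tmp.
Unshelve. all: by end_near. Qed.

(** * Limits, variance identity and projection inequality *)

Section Convergence.
Variables (R : realType) (V : euclideanType R).

(** Polarization reduces the claim to continuity of the norm. *)
Lemma cvg_dotp (u v : nat -> V) (u0 v0 : V) :
  u n @[n --> \oo] --> u0 -> v n @[n --> \oo] --> v0 ->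
  dotp (u n) (v n) @[n --> \oo] --> dotp u0 v0.
Proof.
have polar (s t : V) :
    dotp s t = 2^-1 * (`|s + t| ^+ 2 - `|s| ^+ 2 - `|t| ^+ 2).
  by rewrite normD_sqr; field.
move=> uu vv; rewrite polar.
have -> : (fun n => dotp (u n) (v n)) = (fun n =>
    2^-1 * (`|u n + v n| ^+ 2 - `|u n| ^+ 2 - `|v n| ^+ 2)).
  by apply/funext => n; rewrite polar.
have sq (w : nat -> V) w0 : w n @[n --> \oo] --> w0 ->
    `|w n| ^+ 2 @[n --> \oo] --> `|w0| ^+ 2.
  by move=> ww; apply: cvgM; exact: cvg_norm.
apply: cvgMl_tmp; apply: cvgB; last exact: sq.
by apply: cvgB; [apply: sq; exact: cvgD|exact: sq].
Qed.

Lemma cvg0_le (u : nat -> V) (r : nat -> R) :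
  (forall n, `|u n| <= r n) -> r n @[n --> \oo] --> 0 ->
  u n @[n --> \oo] --> 0.
Proof.
move=> ur r0; apply/norm_cvg0P.
apply: (@squeeze_cvgr _ _ _ _ (fun=> 0) r) => //; last exact: cvg_cst.
by near=> n; rewrite normr_ge0 ur.
Unshelve. all: by end_near. Qed.

Lemma cvg0_sqr_le (u : nat -> V) (c : R) (e : nat -> R) : 0 < c ->
  (forall n, c * `|u n| ^+ 2 <= e n) -> e n @[n --> \oo] --> 0 ->
  u n @[n --> \oo] --> 0.
Proof.
move=> c0 ue e0; apply: (@cvg0_le _ (fun n => Num.sqrt (c^-1 * e n))).
  move=> n; rewrite -[leLHS]normr_id -sqrtr_sqr ler_wsqrtr //.
  by rewrite ler_pdivlMl.
rewrite -sqrtr0.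
apply: (@cvg_comp _ _ _ (fun n => c^-1 * e n) (@Num.sqrt R) _ (nbhs 0)).
  by rewrite -(mulr0 c^-1); apply: cvgMl_tmp; exact: e0.
exact: sqrt_continuous.
Qed.

Lemma cvg_subseq (T : topologicalType) (u : nat -> T) (l : T)
    (phi : nat -> nat) :
  (forall n, (n <= phi n)%N) -> u n @[n --> \oo] --> l ->
  u (phi n) @[n --> \oo] --> l.
Proof.
move=> phin ul; apply: (@cvg_comp _ _ _ phi u \oo \oo _ _ ul).
apply/cvgnyPge => N; near=> n; rewrite (leq_trans _ (phin n)) //.
by near: n; exact: nbhs_infty_ge.
Unshelve. all: by end_near. Qed.

Lemma variance_decomp (I : finType) (omega : I -> R) (u : I -> V) :
  \sum_i omega i = 1 -> let m := \sum_i omega i *: u i in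
  \sum_i omega i * `|u i| ^+ 2 =
    `|m| ^+ 2 + \sum_i omega i * `|u i - m| ^+ 2.
Proof.
move=> om1 m.
have -> : \sum_i omega i * `|u i - m| ^+ 2 = \sum_i (omega i * `|u i| ^+ 2
    - 2 * (omega i * dotp (u i) m) + omega i * `|m| ^+ 2).
  by apply: eq_bigr => i _; rewrite normB_sqr; ring.
rewrite big_split sumrB -mulr_sumr -mulr_suml om1 /=.
have -> : \sum_i omega i * dotp (u i) m = dotp m m.
  by rewrite {2}/m dotp_suml; apply: eq_bigr => i _; rewrite dotpZl.
rewrite -sqr_norm_dotp; ring.
Qed.

(** Expanding $v-w=(p-q)-((p-v)-(q-w))$, the cross term is twice the sum of the two hypotheses.
    Stated without projections, it lets the variational inequality at a solution serve directly as
    the second hypothesis. *)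
Lemma firm_of_var (v w p q : V) :
  0 <= dotp (q - p) (p - v) -> 0 <= dotp (p - q) (q - w) ->
  `|p - q| ^+ 2 + `|(p - v) - (q - w)| ^+ 2 <= `|v - w| ^+ 2.
Proof.
move=> h1 h2.
have -> : v - w = (p - q) - ((p - v) - (q - w)).
  by rewrite !opprB addrA [p - q + _]addrA subrK addrC addrA subrK.
rewrite [leRHS]normB_sqr.
have := h1; rewrite -[q - p]opprB dotpNl => {}h1.
by rewrite (dotpBr (p - v)); lra.
Qed.

End Convergence.

(** * The forward step of one block *)

Section ForwardStep.
Variables (R : realType) (G Theta : euclideanType R) (F : G -> G).
Hypothesis F_fne : firmly_nonexpansive F.

Lemma fne_nonexpansive z1 z2 : `|F z1 - F z2| <= `|z1 - z2|.
Proof.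
have [->|d0] := eqVneq (F z1 - F z2) 0; first by rewrite normr0.
have dn : 0 < `|F z1 - F z2| by rewrite normr_gt0.
by rewrite -(ler_pM2r dn) -expr2 (le_trans (F_fne _ _)) ?cauchy_schwarz.
Qed.

(** With $d=F(Ls)-F(Lt)$, the cross term is at least $2\gamma|d|^2$ by firm nonexpansiveness, and
    the quadratic term at most $\gamma^2\beta|d|^2$. *)
Lemma forward_step (L : {linear Theta -> G}) (y : G) (gamma beta : R) s t :
  0 < gamma -> opnorm L ^+ 2 <= beta ->
  `|(s - gamma *: adjoint L (F (L s) - y)) -
    (t - gamma *: adjoint L (F (L t) - y))| ^+ 2 +
  gamma * (2 - gamma * beta) * `|F (L s) - F (L t)| ^+ 2
    <= `|s - t| ^+ 2.
Proof.
move=> g0 Lb; set d := F (L s) - F (L t).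
set Bs := adjoint L (_ (_ s) - _); set Bt := adjoint L (_ (_ t) - _).
have -> : s - gamma *: Bs - (t - gamma *: Bt) = (s - t) - gamma *: adjoint L d.
  have -> : d = (F (L s) - y) - (F (L t) - y) by rewrite opprB addrA subrK.
  by apply: dotp_inj => w; rewrite adjointB !(dotpBl, dotpZl); ring.
rewrite normB_sqr dotpZr normrZ exprMn gtr0_norm // -adjointP (linearB L).
have h1 := F_fne (L s) (L t); rewrite -/d in h1.
have h2 : `|adjoint L d| ^+ 2 <= beta * `|d| ^+ 2.
  rewrite (@le_trans _ _ ((opnorm L * `|d|) ^+ 2)) //.
    by rewrite ler_sqr ?nnegrE ?mulr_ge0 ?opnorm_ge0 // adjoint_le.
  by rewrite exprMn ler_wpM2r ?sqr_ge0.
have g2 : 0 <= gamma ^+ 2 by exact: sqr_ge0.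
have := ler_wpM2l g2 h2; have := ler_wpM2l (ltW g0) h1.
rewrite -/d; lra.
Qed.

Lemma fne_cvg (L : {linear Theta -> G}) (u v : nat -> Theta) (l : G) :
  u n - v n @[n --> \oo] --> 0 -> F (L (v n)) @[n --> \oo] --> l ->
  F (L (u n)) @[n --> \oo] --> l.
Proof.
move=> uv vl.
have d0 : F (L (u n)) - F (L (v n)) @[n --> \oo] --> 0.
  apply: (@cvg0_le _ _ _ (fun n => opnorm L * `|u n - v n|)).
    move=> n; rewrite (le_trans (fne_nonexpansive _ _)) // -linearB.
    exact: opnorm_le.
  rewrite -(mulr0 (opnorm L)) -(normr0 Theta).
  by apply: cvgMl_tmp; exact: cvg_norm.
rewrite -(add0r l).
have -> : (fun n => F (L (u n))) =
    (fun n => (F (L (u n)) - F (L (v n))) + F (L (v n))).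
  by apply/funext => n; rewrite subrK.
exact: cvgD.
Qed.

End ForwardStep.

(** Induction on the window length: either the final time is active and is [p], or [x] was left
    unchanged there and the shorter window supplies [p]. *)
Lemma last_activation (T : Type) (A : pred nat) (x f : nat -> T) :
  (forall n, x n.+1 = if A n then f n else x n) ->
  forall n P, (exists2 j, (j <= P)%N & A (n + j)%N) ->
  exists p, [/\ (n <= p <= n + P)%N, x (n + P).+1 = f p
    & A (n + P)%N -> p = (n + P)%N].
Proof.
move=> xS n; elim=> [|P IH] [j jP Aj].
  move: jP Aj; rewrite leqn0 addn0 => /eqP->; rewrite addn0 => An.
  by exists n; rewrite leqnn xS An.
have [AP|AP] := boolP (A (n + P.+1)%N).
  by exists (n + P.+1)%N; rewrite leqnn leq_addr xS AP.
have [|p [/andP[np pP] xp _]] := IH.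
  exists j => //; move: jP; rewrite leq_eqVlt => /predU1P[jP|//].
  by move: Aj; rewrite jP (negPf AP).
exists p; split=> //.
  by rewrite np addnS leqW.
by rewrite xS (negPf AP) addnS.
Qed.

(** * Convergence of the scheme, expressed with last activation times *)

Section BlockForwardBackward.
Variables (R : realType) (G Theta : euclideanType R) (C : set Theta).
Hypotheses (C_closed : closed C) (C_convex : convex_set C).
Variable (F : G -> G).
Hypothesis F_fne : firmly_nonexpansive F.
Variables (K : nat) (L : 'I_K -> {linear Theta -> G}) (y : 'I_K -> G).
Variable (omega : 'I_K -> R).
Hypothesis omega_gt0 : forall k, 0 < omega k.
Hypothesis omega_sum : \sum_k omega k = 1.
Variables (gamma beta : R).
Hypotheses (gamma_gt0 : 0 < gamma) (gamma_beta : gamma * beta < 2).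
Hypothesis L_beta : forall k, opnorm (L k) ^+ 2 <= beta.

Let B k t := adjoint (L k) (F (L k t) - y k).
Let sol := VI_solution C (fun t => \sum_k omega k *: B k t).

Variables (theta : nat -> Theta) (vtheta : 'I_K -> nat -> Theta).
(** [p k n] stands for the last activation of block [k] in $[n,n+P]$; the selected index sets enter
    only through the hypotheses on [p]. *)
Variables (P : nat) (p : 'I_K -> nat -> nat).
Hypothesis p_window : forall k n, (n <= p k n <= n + P)%N.
Hypothesis p_last : forall n, exists k, p k n = (n + P)%N.
Hypothesis vthetaE : forall k n, vtheta k (n + P).+1 =
  theta (p k n) - gamma *: B k (theta (p k n)).

Let z n := \sum_k omega k *: vtheta k n.

Hypothesis thetaE : forall n, theta n.+1 = metric_proj C (z n.+1).

(** The block activated at time [n + P] varies with [n], so the descent needs a bound uniform in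
    [k]. *)
Lemma weight_lower_bound :
  exists w, [/\ 0 < w, w <= 1 & forall k, w <= omega k].
Proof.
exists (\big[Num.min/1]_k omega k); split.
- by elim/big_ind : _ => // s t s0 t0; rewrite lt_min s0.
- exact: bigmin_le_id.
- by move=> k; exact: bigmin_le.
Qed.

Section AroundSolution.
Variable q : Theta.
Hypothesis q_sol : sol q.

Let Bq := \sum_k omega k *: B k q.
(** [zq] is the forward average at [q]. [u], [m] and [r] are the deviations from [q] of block,
    average and projection residual; [e] collects the gains of forward steps, averaging and
    projection. *)
Let zq := q - gamma *: Bq.
Let dF k n := F (L k (theta (p k n))) - F (L k q).
Let u k n := vtheta k (n + P).+1 - (q - gamma *: B k q).
Let m n := z (n + P).+1 - zq.
Let r n := (theta (n + P).+1 - z (n + P).+1) - (q - zq).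
Let c := gamma * (2 - gamma * beta).
Let e n := \sum_k omega k * (c * `|dF k n| ^+ 2 + `|u k n - m n| ^+ 2)
  + `|r n| ^+ 2.

Let c_gt0 : 0 < c.
Proof. by rewrite mulr_gt0 // subr_gt0. Qed.

Let mE n : m n = \sum_k omega k *: u k n.
Proof.
rewrite /m /zq /z /Bq /u.
have {1}-> : q = \sum_k omega k *: q by rewrite -scaler_suml omega_sum scale1r.
rewrite scaler_sumr -!sumrB; apply: eq_bigr => k _.
by rewrite !scalerBr !scalerA (mulrC gamma).
Qed.

Let step n M :
  (forall j, (j <= P)%N -> `|theta (n + j)%N - q| ^+ 2 <= M) ->
  forall k0, p k0 n = (n + P)%N ->
  `|theta (n + P).+1 - q| ^+ 2 + e n <=
     M - omega k0 * (M - `|theta (n + P)%N - q| ^+ 2).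
Proof.
move=> aM k0 pk0.
have [Cq qvar] := q_sol.
have C0 : C !=set0 by exists q.
have h1 : `|theta (n + P).+1 - q| ^+ 2 + `|r n| ^+ 2 <= `|m n| ^+ 2.
  apply: firm_of_var.
    by rewrite thetaE; exact: metric_proj_var.
  rewrite /zq subKr dotpZr mulr_ge0 ?(ltW gamma_gt0) // qvar //.
  by rewrite thetaE; have [] := metric_projP (z (n + P).+1) C_closed C0.
have h2 := variance_decomp (fun k => u k n) omega_sum.
rewrite /= -mE in h2.
have h3 k : c * `|dF k n| ^+ 2 + `|u k n| ^+ 2 <= `|theta (p k n) - q| ^+ 2.
  rewrite addrC /u vthetaE; exact: forward_step.
have pM k : `|theta (p k n) - q| ^+ 2 <= M.
  have /andP[np pnP] := p_window k n.
  by rewrite -(subnKC np) aM // leq_subLR.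
have h4 : \sum_k omega k * (c * `|dF k n| ^+ 2 + `|u k n| ^+ 2) <=
    \sum_k omega k * `|theta (p k n) - q| ^+ 2.
  by apply: ler_sum => k _; rewrite ler_wpM2l // ltW.
(* All terms on the right are nonnegative; only that of [k0], last activated at [n + P], is kept. *)
have h5 : omega k0 * (M - `|theta (n + P)%N - q| ^+ 2) <=
    \sum_k omega k * (M - `|theta (p k n) - q| ^+ 2).
  rewrite (bigD1 k0) //= pk0 lerDl sumr_ge0 // => k _.
  by rewrite mulr_ge0 ?subr_ge0 // ltW.
have h6 : \sum_k omega k * (M - `|theta (p k n) - q| ^+ 2) =
    M - \sum_k omega k * `|theta (p k n) - q| ^+ 2.
  under eq_bigr do rewrite mulrBr.
  by rewrite sumrB -mulr_suml omega_sum mul1r.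
have h7 : e n = \sum_k omega k * (c * `|dF k n| ^+ 2) +
    \sum_k omega k * `|u k n - m n| ^+ 2 + `|r n| ^+ 2.
  rewrite /e -big_split /=; congr (_ + _).
  by apply: eq_bigr => k _; rewrite mulrDr.
have h8 : \sum_k omega k * (c * `|dF k n| ^+ 2 + `|u k n| ^+ 2) =
    \sum_k omega k * (c * `|dF k n| ^+ 2) + \sum_k omega k * `|u k n| ^+ 2.
  by rewrite -big_split /=; apply: eq_bigr => k _; rewrite mulrDr.
lra.
Qed.

Let e_terms_ge0 k n :
  0 <= omega k * (c * `|dF k n| ^+ 2 + `|u k n - m n| ^+ 2).
Proof.
apply: mulr_ge0; first exact: ltW.
by apply: addr_ge0; rewrite ?sqr_ge0 // mulr_ge0 ?sqr_ge0 // ltW.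
Qed.

Let e_ge k n :
  omega k * (c * `|dF k n| ^+ 2 + `|u k n - m n| ^+ 2) + `|r n| ^+ 2 <= e n.
Proof.
by rewrite /e lerD2r (bigD1 k) //= lerDl sumr_ge0.
Qed.

Let descent : cvgn (fun n => `|theta n - q| ^+ 2) /\ e n @[n --> \oo] --> 0.
Proof.
have [w [w0 w1 wom]] := weight_lower_bound.
apply: (@asynchronous_descent _ _ _ w P) => [n|n|//|//|n M aM].
- exact: sqr_ge0.
- by rewrite addr_ge0 ?sumr_ge0.
have [k0 pk0] := p_last n; have := step aM pk0.
have := ler_wpM2r _ (wom k0) => /(_ (M - `|theta (n + P)%N - q| ^+ 2)).
by rewrite subr_ge0 aM // => /(_ isT); lra.
Qed.

Lemma cvg_dist_solution : cvgn (fun n => `|theta n - q| ^+ 2).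
Proof. by have [] := descent. Qed.

Let r0 : r n @[n --> \oo] --> 0.
Proof.
have [_ e0] := descent.
apply: (@cvg0_sqr_le _ _ _ 1 e) => // n; rewrite mul1r lerDr sumr_ge0 //.
Qed.

Lemma cvg_residual :
  theta n - z n @[n --> \oo] --> gamma *: Bq.
Proof.
rewrite -(cvg_shiftn P.+1).
have -> : gamma *: Bq = 0 + (q - zq) by rewrite add0r /zq subKr.
have -> : (fun n => theta (n + P.+1)%N - z (n + P.+1)%N) =
    (fun n => r n + (q - zq)).
  by apply/funext => n; rewrite /r subrK addnS.
by apply: cvgD => //; exact: cvg_cst.
Qed.

(** The vanishing of [e] gives this limit along the activation times [p k n]; it transfers to all
    times because [theta (n + P.+1) - theta (p k n)] tends to 0. *)
Lemma cvg_activation k : F (L k (theta n)) @[n --> \oo] --> F (L k q).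
Proof.
have [_ e0] := descent.
have dF0 : dF k n @[n --> \oo] --> 0.
  apply: (@cvg0_sqr_le _ _ _ (omega k * c) e) => //; first by rewrite mulr_gt0.
  move=> n; apply: le_trans (e_ge k n).
  have : 0 <= omega k * `|u k n - m n| ^+ 2 by rewrite mulr_ge0 // ltW.
  by have := sqr_ge0 `|r n|; lra.
have um0 : u k n - m n @[n --> \oo] --> 0.
  apply: (@cvg0_sqr_le _ _ _ (omega k) e) => //.
  move=> n; apply: le_trans (e_ge k n).
  have : 0 <= omega k * (c * `|dF k n| ^+ 2).
    apply: mulr_ge0; first exact: ltW.
    by rewrite mulr_ge0 ?sqr_ge0 // ltW.
  by have := sqr_ge0 `|r n|; lra.
have dB0 : B k (theta (p k n)) - B k q @[n --> \oo] --> 0.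
  apply: (@cvg0_le _ _ _ (fun n => opnorm (L k) * `|dF k n|)).
    move=> n; rewrite /B -adjointB opprB addrA subrK; exact: adjoint_le.
  rewrite -(mulr0 (opnorm (L k))) -(normr0 G).
  by apply: cvgMl_tmp; exact: cvg_norm.
rewrite -(cvg_shiftn P.+1).
apply: (@fne_cvg _ _ _ _ F_fne (L k) (fun n => theta (n + P.+1)%N)
  (fun n => theta (p k n))).
  (* The averages and the values at [q] cancel, leaving three vanishing terms. *)
  have -> : (fun n => theta (n + P.+1)%N - theta (p k n)) = (fun n =>
      r n - (u k n - m n) - gamma *: (B k (theta (p k n)) - B k q)).
    apply/funext => n; rewrite /r /u /m vthetaE addnS.
    by apply: dotp_inj => w; rewrite !(dotpBl, dotpZl); ring.
  have -> : (0 : Theta) = 0 - 0 - gamma *: 0 by rewrite scaler0 !subr0.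
  apply: cvgB; first exact: cvgB.
  by apply: cvgZl_tmp.
rewrite -[F (L k q)]add0r.
have -> : (fun n => F (L k (theta (p k n)))) = (fun n => dF k n + F (L k q)).
  by apply/funext => n; rewrite /dF subrK.
by apply: cvgD => //; exact: cvg_cst.
Qed.

End AroundSolution.

Lemma cvg_VI_solution : sol !=set0 ->
  exists2 theta_lim, sol theta_lim & theta n @[n --> \oo] --> theta_lim.
Proof.
move=> [q q_sol]; have [Cq _] := q_sol.
have C0 : C !=set0 by exists q.
have [M thM] : exists M, forall n, `|theta n| <= M.
  have /cvg_seq_bounded[A [_ /(_ (A + 1))]] := cvg_dist_solution q_sol.
  rewrite ltrDl ltr01 => /(_ isT) hA.
  (* For $s=|\theta_n-q|$, $2s\le s^2+1\le A+2$ bounds $s$ without a square root. *)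
  exists (A + 2 + `|q|) => n.
  rewrite -[theta n](subrK q) (le_trans (ler_normD _ _)) // lerD2r.
  have := hA n I; rewrite /= ger0_norm ?sqr_ge0 //.
  have := sqr_ge0 (`|theta n - q| - 1); nra.
have [tl [phi phin thl]] := bounded_cvg_subseq thM.
have Ftl k : F (L k tl) = F (L k q).
  have h1 := cvg_subseq phin (cvg_activation q_sol (k := k)).
  have h2 : F (L k (theta (phi n))) @[n --> \oo] --> F (L k tl).
    apply: (@fne_cvg _ _ _ _ F_fne (L k) _ (fun=> tl)); last exact: cvg_cst.
    by rewrite -(subrr tl); apply: cvgB => //; exact: cvg_cst.
  exact: (cvg_unique _ h2 h1).
(* The starting point is arbitrary, so membership in [C] begins at index 1. *)
have Cth n : (0 < n)%N -> C (theta n).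
  case: n => // n _; rewrite thetaE.
  by have [] := metric_projP (z n.+1) C_closed C0.
have Ctl : C tl.
  apply: (closed_cvg _ C_closed _ _ thl).
  by exists 1%N => // n n0; apply: Cth; exact: leq_trans n0 (phin n).
have tl_sol : sol tl.
  split=> // d Cd.
  have -> : \sum_k omega k *: B k tl = \sum_k omega k *: B k q.
    by apply: eq_bigr => k _; rewrite /B Ftl.
  (* Scaling by [gamma] makes the pairing the limit of projection inequalities along the
     subsequence. *)
  rewrite -(pmulr_rge0 _ gamma_gt0) -dotpZr.
  have h1 := cvg_subseq phin (cvg_residual q_sol).
  have h2 : d - theta (phi n) @[n --> \oo] --> d - tl.
    by apply: cvgB => //; exact: cvg_cst.
  have h3 := cvg_dotp h2 h1.
  apply: (closed_cvg _ (@closed_ge _ 0) _ _ h3).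
  exists 1%N => // n n0.
  have : (0 < phi n)%N := leq_trans n0 (phin n).
  case: (phi n) => // i _; rewrite /= thetaE; exact: metric_proj_var.
exists tl => //.
have /cvg_ex[/= l al] := cvg_dist_solution tl_sol.
have l0 : l = 0.
  have h1 := cvg_subseq phin al.
  have h2 : `|theta (phi n) - tl| ^+ 2 @[n --> \oo] --> (0 : R).
    have h : `|theta (phi n) - tl| @[n --> \oo] --> (0 : R).
      rewrite -(normr0 Theta) -(subrr tl); apply: cvg_norm.
      by apply: cvgB => //; exact: cvg_cst.
    by rewrite -(mulr0 0); apply: cvgM.
  exact: (cvg_unique _ h1 h2).
rewrite l0 in al; apply/subr_cvg0.
by apply: (@cvg0_sqr_le _ _ _ 1 _ _ _ al) => // n; rewrite mul1r.
Qed.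

End BlockForwardBackward.

Unset Implicit Arguments.

(** * Last activation times extracted from the covering condition *)

Theorem proposition2 (R : realType) (H G Theta : euclideanType R)
  (C : set Theta) (C_closed : closed C) (C_convex : convex_set C)
  (F : G -> G) (F_fne : firmly_nonexpansive F)
  (Wb : {linear Theta -> ('Hom(H, G) * G)%type})
  (K : nat) (x : 'I_K -> H) (y : 'I_K -> G)
  (omega : 'I_K -> R) (omega01 : forall k : 'I_K, 0 < omega k < 1)
  (omega_sum : \sum_(k < K) omega k = 1) :
  let L (k : 'I_K) : {linear Theta -> G} := layer Wb (x k) in
  let VI : set Theta := VI_solution C (fun t : Theta =>
    \sum_(k < K) omega k *: adjoint (L k) (F (L k t) - y k)) in
  VI !=set0 ->
  forall (gamma : R) (theta0 : Theta) (vtheta0 : 'I_K -> Theta)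
    (KK : nat -> {set 'I_K}) (theta : nat -> Theta)
    (vtheta : 'I_K -> nat -> Theta),
  (0 < gamma%:E < 2%:E / (\big[Num.max/0%R]_(k < K) (opnorm (L k) ^+ 2)%R)%:E)%E ->
  (forall n : nat, KK n != finset.set0) ->
  theta 0%N = theta0 ->
  (forall k : 'I_K, vtheta k 0%N = vtheta0 k) ->
  (forall (k : 'I_K) (n : nat), vtheta k n.+1 =
     if k \in KK n
     then theta n - gamma *: adjoint (L k) (F (L k (theta n)) - y k)
     else vtheta k n) ->
  (forall n : nat,
     theta n.+1 = metric_proj C (\sum_(k < K) omega k *: vtheta k n.+1)) ->
  (exists P : nat, forall n : nat,
     (\bigcup_(k < P) KK (n + k)%N)%SET = [set: 'I_K]%SET) ->
  exists2 theta_lim : Theta, VI theta_lim & theta n @[n --> \oo] --> theta_lim.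
Proof.
move=> L VI VI0 gamma theta0 vtheta0 KK theta vtheta.
set beta := \big[Num.max/0]_(k < K) _ => /andP[]; rewrite lte_fin => g0 gb.
move=> KK0 _ _ vthetaS thetaS [P KKP].
have beta_ge0 : 0 <= beta by exact: bigmax_ge_id.
have gamma_beta : gamma * beta < 2.
  (* In the extended reals, division by [beta = 0] gives an infinite bound; then
     [gamma * beta = 0]. *)
  move: gb; rewrite inver; case: eqVneq => [->|b0]; first by rewrite mulr0.
  by rewrite -EFinM lte_fin ltr_pdivlMr // lt_neqAle eq_sym b0.
have L_beta k : opnorm (L k) ^+ 2 <= beta by exact: le_bigmax.
have /choice[p hp] : forall i : 'I_K * nat, exists p : nat,
    [/\ (i.2 <= p <= i.2 + P)%N, vtheta i.1 (i.2 + P).+1 =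
      theta p - gamma *: adjoint (L i.1) (F (L i.1 (theta p)) - y i.1)
    & i.1 \in KK (i.2 + P)%N -> p = (i.2 + P)%N].
  move=> [k n] /=.
  apply: (@last_activation _ (fun n => k \in KK n) _ (fun n =>
    theta n - gamma *: adjoint (L k) (F (L k (theta n)) - y k))) => //.
  have : k \in (\bigcup_(j < P) KK (n + j)%N)%SET by rewrite KKP inE.
  (* The covering gives [j < P]; the window used reaches one step further, to [n + P]. *)
  by case/bigcupP => j _ kj; exists j => //; exact/ltnW.
apply: (@cvg_VI_solution _ _ _ _ C_closed C_convex F F_fne K L y omega _
  omega_sum gamma beta g0 gamma_beta L_beta theta vtheta P
  (fun k n => p (k, n))) => //.
- by move=> k; have /andP[] := omega01 k.
- by move=> k n; have [] := hp (k, n).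
(* A block selected at time [n + P] has its last activation there. *)
- move=> n; have /finset.set0Pn[k kn] := KK0 (n + P)%N.
  by exists k; have [_ _ ->] := hp (k, n).
- by move=> k n; have [] := hp (k, n).
Qed.
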